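(* Let $\mathcal{C}$ be a congruence-modular equational class of algebras such that $[\nabla_M,\nabla_M]_M=\nabla_M$ for every algebra $M$ from $\mathcal{C}$. Let $n\in\mathbb{N}$, $n\ge 1$, let $A_1,\ldots,A_n$ be algebras from $\mathcal{C}$, and let $A=\prod_{i=1}^nA_i$. Then: (1) $\mathrm{Con}_2(A)=\bigcup_{i=1}^n\{\theta_i\times\prod_{j\in\{1,\ldots,n\}\setminus\{i\}}\nabla_{A_j} : \theta_i\in \mathrm{Con}_2(A_i)\}$; (2) $\mathrm{Max}(A)=\bigcup_{i=1}^n\{\theta_i\times\prod_{j\in\{1,\ldots,n\}\setminus\{i\}}\nabla_{A_j} : \theta_i\in \mathrm{Max}(A_i)\}$; moreover, $\mathrm{Max}(A)=\mathrm{Con}_2(A)$ iff $\mathrm{Max}(A_i)=\mathrm{Con}_2(A_i)$ for all $i\in\{1,\ldots,n\}$; (3) $\mathrm{Spec}(A)=\bigcup_{i=1}^n\{\theta_i\times\prod_{j\in\{1,\ldots,n\}\setminus\{i\}}\nabla_{A_j} : \theta_i\in \mathrm{Spec}(A_i)\}$; moreover, $\mathrm{Spec}(A)=\mathrm{Con}_2(A)$ iff $\mathrm{Spec}(A_i)=\mathrm{Con}_2(A_i)$ for all $i\in\{1,\ldots,n\}$; and $\mathrm{Spec}(A)=\mathrm{Max}(A)$ iff $\mathrm{Spec}(A_i)=\mathrm{Max}(A_i)$ for all $i\in\{1,\ldots,n\}$.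
   Context: All algebras are non-empty. $\mathrm{Con}(M)$ is the lattice of congruences of $M$ ordered by inclusion, with greatest element $\nabla_M=M^2$. $\mathrm{Con}_2(M)=\{\theta\in \mathrm{Con}(M) : |M/\theta|=2\}$. $\mathrm{Max}(M)$ is the set of maximal elements of $\mathrm{Con}(M)\setminus\{\nabla_M\}$. The direct product of binary relations is $\prod_i R_i=\{((a_i)_i,(b_i)_i) : (a_i,b_i)\in R_i\text{ for all }i\}$; in $\theta_i\times\prod_{j\neq i}\nabla_{A_j}$ the factor $\theta_i$ is in the $i$-th coordinate. An equational class (variety) is congruence-modular if $\mathrm{Con}(M)$ is modular for each member $M$. In a congruence-modular equational class, $[\alpha,\beta]_M$ denotes the (Freese–McKenzie) commutator of $\alpha,\beta\in \mathrm{Con}(M)$: the least $\delta\in \mathrm{Con}(M)$ such that for all $m,n$, every $(m+n)$-ary term $t$, all $(a_i,b_i)\in\alpha$ ($1\le i\le m$) and all $(c_j,d_j)\in\beta$ ($1\le j\le n$), $(t(\bar a,\bar c),t(\bar a,\bar d))\in\delta$ implies $(t(\bar b,\bar c),t(\bar b,\bar d))\in\delta$. A proper congruence $\phi\neq\nabla_M$ is prime if, for all $\alpha,\beta\in \mathrm{Con}(M)$, $[\alpha,\beta]_M\subseteq\phi$ implies $\alpha\subseteq\phi$ or $\beta\subseteq\phi$; $\mathrm{Spec}(M)$ is the set of prime congruences of $M$. For a congruence-modular $\mathcal{C}$ it is known (Freese–McKenzie, Theorem 8.5) that the following are equivalent: $[\nabla_M,\nabla_M]_M=\nabla_M$ for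 all $M$ in $\mathcal{C}$; $[\theta,\nabla_M]_M=\theta$ for all $M$ in $\mathcal{C}$ and $\theta\in \mathrm{Con}(M)$; for all finite families $M_1,\ldots,M_n$ in $\mathcal{C}$, the congruences of $\prod_i M_i$ are exactly the products $\prod_i\theta_i$ with $\theta_i\in \mathrm{Con}(M_i)$. *)

(* Defs.v *)
From mathcomp Require Import all_boot.
From mathcomp Require Import boolp classical_sets functions cardinality.

Set Implicit Arguments.
Unset Strict Implicit.
Unset Printing Implicit Defensive.

Local Open Scope classical_set_scope.
Local Open Scope card_scope.

Record signature := Signature {
  symbol : Type;
  arity : symbol -> nat }.

Record algebra (S : signature) := Algebra {
  carrier :> Type;
  interp : forall f : symbol S, ('I_(arity f) -> carrier) -> carrier;
  carrier_inhabited : inhabited carrier }.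

Arguments interp {S} _ _ _.

Inductive term (S : signature) (V : Type) : Type :=
| Var of V
| App (f : symbol S) of ('I_(arity f) -> term S V).

Fixpoint eval (S : signature) (M : algebra S) (V : Type) (e : V -> M)
    (t : term S V) : M :=
  match t with
  | Var v => e v
  | App f ts => interp M f (fun i => eval e (ts i))
  end.

Definition satisfies (S : signature) (M : algebra S)
    (E : term S nat -> term S nat -> Prop) : Prop :=
  forall s t, E s t -> forall e : nat -> M, eval e s = eval e t.

(* [set (algebra S)] would be universe-inconsistent, so C is a plain predicate. *)
Definition equational_class (S : signature) (C : algebra S -> Prop) : Prop :=
  exists E, forall M, C M <-> satisfies M E.

Lemma prod_inhabited (S : signature) (I : Type) (A : I -> algebra S) :
  inhabited (forall i, A i).
Proof.
have ex i : exists _ : A i, True by have [x] := carrier_inhabited (A i); exists x.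
exact: inhabits (fun i => projT1 (cid (ex i))).
Qed.

Definition prod_algebra (S : signature) (I : Type) (A : I -> algebra S) :
    algebra S :=
  {| carrier := forall i, A i;
     interp f x := fun i => interp (A i) f (fun k => x k i);
     carrier_inhabited := prod_inhabited A |}.

Definition prod_rel (S : signature) (I : Type) (A : I -> algebra S)
    (R : forall i, set (A i * A i)) :
    set (prod_algebra A * prod_algebra A) :=
  [set p | forall i, R i (p.1 i, p.2 i)].

(* [theta] at coordinate [i], the full relation at the other coordinates. *)
Definition at_coord (S : signature) (I : eqType) (A : I -> algebra S) (i : I)
    (theta : set (A i * A i)) : set (prod_algebra A * prod_algebra A) :=
  prod_rel (dfwith (fun j => [set: A j * A j]) theta).

Arguments at_coord {S I} A i theta.

Section Congruences.
Variables (S : signature) (M : algebra S).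
Implicit Types (alpha beta delta theta : set (M * M)).

Record congruence theta : Prop := Congruence {
  cong_refl : forall x, theta (x, x);
  cong_sym : forall x y, theta (x, y) -> theta (y, x);
  cong_trans : forall x y z, theta (x, y) -> theta (y, z) -> theta (x, z);
  cong_interp : forall f (x y : 'I_(arity f) -> M),
    (forall k, theta (x k, y k)) -> theta (interp M f x, interp M f y) }.

Definition Con : set (set (M * M)) := [set theta | congruence theta].

Definition con_join alpha beta : set (M * M) :=
  smallest Con (alpha `|` beta).

Definition con_modular : Prop :=
  forall alpha beta gamma, Con alpha -> Con beta -> Con gamma ->
    alpha `<=` gamma ->
    con_join alpha (beta `&` gamma) = con_join alpha beta `&` gamma.

Definition quotient theta : set (set M) :=
  range (fun x => [set y | theta (x, y)]).

Definition Con2 : set (set (M * M)) :=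
  [set theta | Con theta /\ quotient theta #= `I_2].

Definition Max : set (set (M * M)) :=
  [set theta | (Con `\ setT) theta /\
    forall psi, (Con `\ setT) psi -> theta `<=` psi -> psi = theta].

Definition concat (m n : nat) (a : 'I_m -> M) (c : 'I_n -> M) (k : 'I_(m + n)) :
    M :=
  match fintype.split k with inl i => a i | inr j => c j end.

Definition centralizes alpha beta delta : Prop :=
  forall (m n : nat) (t : term S 'I_(m + n))
    (a b : 'I_m -> M) (c d : 'I_n -> M),
    (forall i, alpha (a i, b i)) -> (forall j, beta (c j, d j)) ->
    delta (eval (concat a c) t, eval (concat a d) t) ->
    delta (eval (concat b c) t, eval (concat b d) t).

Definition commutator alpha beta : set (M * M) :=
  \bigcap_(delta in [set delta | Con delta /\ centralizes alpha beta delta])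
    delta.

Definition Spec : set (set (M * M)) :=
  [set phi | Con phi /\ phi <> setT /\
    forall alpha beta, Con alpha -> Con beta ->
      commutator alpha beta `<=` phi -> alpha `<=` phi \/ beta `<=` phi].

Lemma bigcap_Con (D : set (set (M * M))) :
  D `<=` Con -> Con (\bigcap_(delta in D) delta).
Proof.
move=> sD; split=> [x d /sD[]//|x y h d Dd|x y z h1 h2 d Dd|f x y h d Dd].
- by have /cong_sym := sD d Dd; apply; apply: h.
- by have /cong_trans := sD d Dd; apply; [apply: h1|apply: h2].
- by have /cong_interp := sD d Dd; apply => k; apply: h.
Qed.

Lemma con_joinP alpha beta :
  [/\ Con (con_join alpha beta), alpha `<=` con_join alpha beta,
      beta `<=` con_join alpha beta &
      forall gamma, Con gamma -> alpha `<=` gamma -> beta `<=` gamma ->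
        con_join alpha beta `<=` gamma].
Proof.
split; first by apply: bigcap_Con => d [].
- by apply: sub_smallest => x; left.
- by apply: sub_smallest => x; right.
- by move=> g Cg ag bg; apply: smallest_sub => // x [/ag|/bg].
Qed.

(* The intersection defining the commutator is the least element of the family
   it is taken over. *)
Lemma commutatorP alpha beta :
  [/\ Con (commutator alpha beta),
      centralizes alpha beta (commutator alpha beta) &
      forall delta, Con delta -> centralizes alpha beta delta ->
        commutator alpha beta `<=` delta].
Proof.
split; first by apply: bigcap_Con => d [].
- move=> m n t a b c d ab cd h e [Ce Ze].
  by apply: (Ze m n t a b c d ab cd); apply: h.
- by move=> d Cd Zd x; apply.
Qed.

End Congruences.

Arguments Con {S} M.
Arguments Con2 {S} M.
Arguments Max {S} M.
Arguments Spec {S} M.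

Definition congruence_modular (S : signature) (C : algebra S -> Prop) : Prop :=
  forall M, C M -> con_modular M.

(* Main.v *)
Require Import Defs.
From mathcomp Require Import all_boot.
From mathcomp Require Import boolp classical_sets functions cardinality.

(* Everything reduces to the fact that a congruence theta of a finite product
   is a product of congruences. Let eta, eta' be complementary factor
   congruences and gamma = (eta v theta) /\ (eta' v theta). The modular law in
   the algebra alpha <= M^2 shows that alpha /\ beta <= delta implies that
   alpha centralizes beta v delta modulo delta. Applied to eta and eta', it
   gives that 1 = eta o eta' centralizes gamma modulo theta, so that some
   congruence of the algebra gamma <= M^2 identifies all diagonal pairs but
   separates them from the pairs outside theta. Applied to the two projection
   kernels of gamma, it gives that 1 centralizes 1 modulo any congruence
   identifying all diagonal pairs; since [1, 1] = 1 such a congruence is full,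
   whence gamma <= theta. *)

Set Implicit Arguments.
Unset Strict Implicit.
Unset Printing Implicit Defensive.

Local Open Scope classical_set_scope.

(** * Homomorphisms, term evaluation and basic congruences *)

Definition hom (S : signature) (M N : algebra S) (h : M -> N) : Prop :=
  forall f x, h (interp M f x) = interp N f (h \o x).

Lemma hom_eval (S : signature) (M N : algebra S) (h : M -> N) (V : Type)
    (e : V -> M) (t : term S V) : hom h -> h (eval e t) = eval (h \o e) t.
Proof.
move=> hh; elim: t => //= f ts IH; rewrite hh; congr interp.
by apply/funext => i /=; rewrite IH.
Qed.

Lemma eval_cong (S : signature) (M : algebra S) (theta : set (M * M))
    (V : Type) (e e' : V -> M) (t : term S V) :
  Con M theta -> (forall v, theta (e v, e' v)) ->
  theta (eval e t, eval e' t).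
Proof. by move=> Ct h; elim: t => //= f ts IH; apply: (cong_interp Ct). Qed.

Lemma Con_preimage (S : signature) (M N : algebra S) (h : M -> N)
    (theta : set (N * N)) :
  hom h -> Con N theta -> Con M [set p | theta (h p.1, h p.2)].
Proof.
move=> hh Ct; split=> /= [x|x y|x y z|f x y xy].
- exact: cong_refl.
- exact: cong_sym.
- exact: cong_trans.
- by rewrite !hh; apply: (cong_interp Ct).
Qed.

Lemma Con_diag (S : signature) (M : algebra S) : Con M [set p | p.1 = p.2].
Proof.
split=> //= [x y z -> //|f x y xy]; congr interp.
by apply/funext => k; apply: xy.
Qed.

Lemma ConI (S : signature) (M : algebra S) (alpha beta : set (M * M)) :
  Con M alpha -> Con M beta -> Con M (alpha `&` beta).
Proof.
move=> Ca Cb; split=> /= [x|x y []|x y z [? ?] []|f x y xy].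
- by split; apply: cong_refl.
- by split; apply: cong_sym.
- by split; [apply: (cong_trans Ca)|apply: (cong_trans Cb)]; eauto.
- by split; [apply: (cong_interp Ca)|apply: (cong_interp Cb)] => k;
    case: (xy k).
Qed.

Lemma Con_join (S : signature) (M : algebra S) (alpha beta : set (M * M)) :
  Con M (con_join alpha beta).
Proof. by case: (con_joinP alpha beta). Qed.

Lemma con_joinl (S : signature) (M : algebra S) (alpha beta : set (M * M)) :
  alpha `<=` con_join alpha beta.
Proof. by case: (con_joinP alpha beta). Qed.

Lemma con_joinr (S : signature) (M : algebra S) (alpha beta : set (M * M)) :
  beta `<=` con_join alpha beta.
Proof. by case: (con_joinP alpha beta). Qed.

Lemma con_join_sub (S : signature) (M : algebra S)
    (alpha beta gamma : set (M * M)) :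
  Con M gamma -> alpha `<=` gamma -> beta `<=` gamma ->
  con_join alpha beta `<=` gamma.
Proof. by case: (con_joinP alpha beta) => _ _ _; apply. Qed.

(** The hybrids [h j], equal to [y] below [j] and to [x] from [j] on, form a chain from [x] to [y]
    whose consecutive members differ in one coordinate only. *)
Lemma hybrid_ind (n : nat) (X : 'I_n -> Type)
    (T : (forall i, X i) -> (forall i, X i) -> Prop) (x y : forall i, X i) :
  (forall z, T z z) -> (forall u v w, T u v -> T v w -> T u w) ->
  (forall i z, T (dfwith z (x i)) (dfwith z (y i))) -> T x y.
Proof.
move=> Tr Tt Ts.
pose h j i : X i := if (i < j)%N then y i else x i.
suff H j : (j <= n)%N -> T x (h j).
  have -> : y = h n.
    by apply/functional_extensionality_dep => i; rewrite /h ltn_ord.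
  exact: H.
elim: j => [_|j IH jn].
  have -> : h 0 = x by apply/functional_extensionality_dep.
  exact: Tr.
apply: (Tt _ _ _ (IH (ltnW jn))).
(* At index [j] the hybrid [h j] still has the value of [x], so resetting it there to [x] changes
   nothing, while resetting it to [y] gives [h j.+1]. *)
have := Ts (Ordinal jn) (h j).
congr T; apply/functional_extensionality_dep => i; case: dfwithP => [|k].
- by rewrite /h ltnn.
- by [].
- by rewrite /h ltnSn.
- move=> /eqP/val_eqP /= jk; rewrite /h ltnS.
  by rewrite [in RHS]leq_eqVlt eq_sym (negPf jk).
Qed.

(** * A congruence as a subalgebra of the square *)

(** Membership is stated of [(p.1, p.2)] rather than [p], to match the pairs in the fields of
    [congruence] directly. *)
Definition rel_algebra (S : signature) (M : algebra S) (gamma : set (M * M))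
    (Cg : Con M gamma) : algebra S :=
  {| carrier := {p : M * M | gamma (p.1, p.2)};
     interp f x :=
       exist (fun p : M * M => gamma (p.1, p.2))
         (interp M f (fun k => (sval (x k)).1),
          interp M f (fun k => (sval (x k)).2))
         (cong_interp Cg (fun k => svalP (x k)));
     carrier_inhabited :=
       let: inhabits x := carrier_inhabited M in
       inhabits (exist _ (x, x) (cong_refl Cg x)) |}.

Definition rel_pair (S : signature) (M : algebra S) (gamma : set (M * M))
    (Cg : Con M gamma) (x y : M) (xy : gamma (x, y)) : rel_algebra Cg :=
  exist (fun p : M * M => gamma (p.1, p.2)) (x, y) xy.

Definition rel_diag (S : signature) (M : algebra S) (gamma : set (M * M))
    (Cg : Con M gamma) (x : M) : rel_algebra Cg :=
  rel_pair Cg (cong_refl Cg x).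

Definition rel_fst (S : signature) (M : algebra S) (gamma : set (M * M))
    (Cg : Con M gamma) (p : rel_algebra Cg) : M := (sval p).1.

Definition rel_snd (S : signature) (M : algebra S) (gamma : set (M * M))
    (Cg : Con M gamma) (p : rel_algebra Cg) : M := (sval p).2.

Lemma rel_algebraP (S : signature) (M : algebra S) (gamma : set (M * M))
    (Cg : Con M gamma) (p : rel_algebra Cg) : gamma (rel_fst p, rel_snd p).
Proof. exact: (svalP p). Qed.

Lemma rel_algebra_eq (S : signature) (M : algebra S) (gamma : set (M * M))
    (Cg : Con M gamma) (p q : rel_algebra Cg) :
  rel_fst p = rel_fst q -> rel_snd p = rel_snd q -> p = q.
Proof.
case: p q => [[x y] xy] [[x' y'] xy']; rewrite /rel_fst /rel_snd /= => ex ey.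
by subst; congr exist; apply: Prop_irrelevance.
Qed.

Lemma hom_rel_fst (S : signature) (M : algebra S) (gamma : set (M * M))
    (Cg : Con M gamma) : hom (@rel_fst S M gamma Cg).
Proof. by []. Qed.

Lemma hom_rel_snd (S : signature) (M : algebra S) (gamma : set (M * M))
    (Cg : Con M gamma) : hom (@rel_snd S M gamma Cg).
Proof. by []. Qed.

Lemma hom_rel_diag (S : signature) (M : algebra S) (gamma : set (M * M))
    (Cg : Con M gamma) : hom (rel_diag Cg).
Proof. by move=> f x; apply: rel_algebra_eq. Qed.

Lemma hom_proj (S : signature) (I : Type) (A : I -> algebra S) (i : I) :
  @hom S (prod_algebra A) (A i) (fun a => a i).
Proof. by []. Qed.

Lemma equational_rel (S : signature) (C : algebra S -> Prop) (M : algebra S)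
    (gamma : set (M * M)) (Cg : Con M gamma) :
  equational_class C -> C M -> C (rel_algebra Cg).
Proof.
move=> [E EC] /EC CM; apply/EC => s t st e; apply: rel_algebra_eq.
- by rewrite !(hom_eval _ _ (@hom_rel_fst _ _ _ _)); apply: CM.
- by rewrite !(hom_eval _ _ (@hom_rel_snd _ _ _ _)); apply: CM.
Qed.

Lemma equational_prod (S : signature) (C : algebra S -> Prop) (I : Type)
    (A : I -> algebra S) :
  equational_class C -> (forall i, C (A i)) -> C (prod_algebra A).
Proof.
move=> [E EC] CA; apply/EC => s t st e.
apply/functional_extensionality_dep => i.
by rewrite !(hom_eval _ _ (@hom_proj _ _ _ i)); apply: (iffLR (EC _) (CA i)).
Qed.

(** * Consequences of the modular law *)

(** Gumm's shifting lemma. Modularity gives (beta /\ delta) v (alpha /\ beta) = ((beta /\ delta) v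
    alpha) /\ beta. The left side is below delta, and the right side contains [(y, y')] through the
    path [y], [x], [x'], [y']. *)
Lemma shifting (S : signature) (M : algebra S) (alpha beta delta : set (M * M))
    (x x' y y' : M) :
  con_modular M -> Con M alpha -> Con M beta -> Con M delta ->
  alpha `&` beta `<=` delta ->
  alpha (x, y) -> alpha (x', y') -> beta (x, x') -> beta (y, y') ->
  delta (x, x') -> delta (y, y').
Proof.
move=> mod Ca Cb Cd abd axy axy' bxx byy dxx.
have Cbd := ConI Cb Cd.
suff: con_join (beta `&` delta) (alpha `&` beta) (y, y').
  by apply: con_join_sub => // p [].
rewrite mod//; split=> //.
have Cj := Con_join (beta `&` delta) alpha.
apply: (cong_trans Cj (y := x)).
  by apply: con_joinr; apply: cong_sym.
apply: (cong_trans Cj (y := x')); last exact: con_joinr.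
exact: con_joinl.
Qed.

(** The term condition for alpha and beta v delta modulo delta, with each variable declaring in
    which of the two directions it moves; [V] is arbitrary so that polynomials are covered as well.
    In the algebra alpha, the columns ([e00], [e10]) and ([e01], [e11]) are compared modulo the join
    [J]. *)
Lemma centralizes_join (S : signature) (C : algebra S -> Prop)
    (M : algebra S) (alpha beta delta : set (M * M)) (V : Type) (t : term S V)
    (e00 e01 e10 e11 : V -> M) :
  equational_class C -> congruence_modular C -> C M ->
  Con M alpha -> Con M beta -> Con M delta -> alpha `&` beta `<=` delta ->
  (forall v,
     alpha (e00 v, e10 v) /\ e01 v = e00 v /\ e11 v = e10 v \/
     con_join beta delta (e00 v, e01 v) /\ e10 v = e00 v /\ e11 v = e01 v) ->
  delta (eval e00 t, eval e01 t) -> delta (eval e10 t, eval e11 t).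
Proof.
move=> Ceq Cmod CM Ca Cb Cd abd he.
pose K := rel_algebra Ca.
have CK : con_modular K by apply: Cmod; apply: equational_rel.
pose D0 : set (K * K) := [set p | delta (rel_fst p.1, rel_fst p.2)].
pose D1 : set (K * K) := [set p | delta (rel_snd p.1, rel_snd p.2)].
pose E0 : set (K * K) := [set p | beta (rel_fst p.1, rel_fst p.2)].
pose E1 : set (K * K) := [set p | beta (rel_snd p.1, rel_snd p.2)].
have CD0 : Con K D0 := Con_preimage (@hom_rel_fst _ _ _ Ca) Cd.
have CD1 : Con K D1 := Con_preimage (@hom_rel_snd _ _ _ Ca) Cd.
have CE : Con K (E0 `&` E1).
  by apply: ConI; [exact: (Con_preimage (@hom_rel_fst _ _ _ Ca) Cb)
                  |exact: (Con_preimage (@hom_rel_snd _ _ _ Ca) Cb)].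
have CD := ConI CD0 CD1.
(* The shifting lemma, on the rectangle whose alpha-sides are the pairs [p] and [q]. *)
have sh : (E0 `&` E1) `&` D0 `<=` D1.
  move=> [p q] [[/= e0 e1] d0].
  exact: (shifting (Cmod _ CM) Ca Cb Cd abd (rel_algebraP p) (rel_algebraP q)).
pose J := con_join (D0 `&` D1) (E0 `&` E1).
have CJ : Con K J := Con_join _ _.
(* The diagonal embedding pulls [J] back to a congruence of [M] above both beta and delta. *)
have bJ : con_join beta delta `<=`
    [set p | J (rel_diag Ca p.1, rel_diag Ca p.2)].
  apply: con_join_sub.
  - exact: Con_preimage (@hom_rel_diag _ _ _ Ca) CJ.
  - by move=> [x y] bxy; apply: con_joinr.
  - by move=> [x y] bxy; apply: con_joinl.
have ha v : alpha (e00 v, e10 v).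
  by case: (he v) => [[]//|[_ [-> _]]]; apply: cong_refl.
have hb v : alpha (e01 v, e11 v).
  by case: (he v) => [[? [-> ->]]//|[_ [_ ->]]]; apply: cong_refl.
pose L v : K := rel_pair Ca (ha v); pose R v : K := rel_pair Ca (hb v).
have JLR : J (eval L t, eval R t).
  apply: (eval_cong _ CJ) => v; case: (he v) => [[_ [h01 h11]]|[hbd [h10 h11]]].
    have -> : R v = L v by apply: rel_algebra_eq.
    exact: cong_refl.
  have -> : L v = rel_diag Ca (e00 v) by apply: rel_algebra_eq.
  have -> : R v = rel_diag Ca (e01 v) by apply: rel_algebra_eq.
  exact: bJ hbd.
have <- : rel_fst (eval L t) = eval e00 t
  by rewrite (hom_eval _ _ (@hom_rel_fst _ _ _ _)).
have <- : rel_fst (eval R t) = eval e01 t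
  by rewrite (hom_eval _ _ (@hom_rel_fst _ _ _ _)).
have <- : rel_snd (eval L t) = eval e10 t
  by rewrite (hom_eval _ _ (@hom_rel_snd _ _ _ _)).
have <- : rel_snd (eval R t) = eval e11 t
  by rewrite (hom_eval _ _ (@hom_rel_snd _ _ _ _)).
move=> D0LR.
(* The modular law in [K]: since [D0 /\ D1] is below [D0], the meet of [J] and [D0] is the join of
   [D0 /\ D1] and [E0 /\ E1 /\ D0], both of which lie below [D1]. *)
have : con_join (D0 `&` D1) ((E0 `&` E1) `&` D0) (eval L t, eval R t).
  by rewrite (CK _ _ _ CD CE CD0) => [|p []].
by apply: (con_join_sub CD1 _ sh) => p [].
Qed.

(* The projection kernels eta0, eta1 of [rel_algebra Cg] satisfy
   eta0 v delta = eta1 v delta = 1 and eta0 /\ eta1 = 0, so that 1 centralizes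
   1 modulo delta. *)
Lemma rel_diag_full (S : signature) (C : algebra S -> Prop) (M : algebra S)
    (gamma : set (M * M)) (Cg : Con M gamma)
    (delta : set (rel_algebra Cg * rel_algebra Cg)) :
  equational_class C -> congruence_modular C ->
  (forall N : algebra S, C N ->
     commutator [set: N * N] [set: N * N] = [set: N * N]) ->
  C M -> Con (rel_algebra Cg) delta ->
  (forall x y, delta (rel_diag Cg x, rel_diag Cg y)) -> delta = setT.
Proof.
move=> Ceq Cmod Ccomm CM Cd dd; set R := rel_algebra Cg.
have CR : C R by apply: equational_rel.
pose eta0 : set (R * R) := [set p | rel_fst p.1 = rel_fst p.2].
pose eta1 : set (R * R) := [set p | rel_snd p.1 = rel_snd p.2].
have C0 : Con R eta0 := Con_preimage (@hom_rel_fst _ _ _ Cg) (@Con_diag _ M).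
have C1 : Con R eta1 := Con_preimage (@hom_rel_snd _ _ _ Cg) (@Con_diag _ M).
have e01 : eta0 `&` eta1 `<=` delta.
  move=> [p q] [/= h0 h1]; have -> := @rel_algebra_eq _ _ _ _ p q h0 h1.
  exact: (cong_refl Cd).
have join1 p q : con_join eta1 delta (p, q).
  have Cj := Con_join eta1 delta.
  apply: (cong_trans Cj (y := rel_diag Cg (rel_snd p))).
    exact: con_joinl.
  apply: (cong_trans Cj (y := rel_diag Cg (rel_snd q))).
    by apply: con_joinr; apply: dd.
  exact: con_joinl.
apply/seteqP; split=> //; rewrite -(Ccomm R CR).
have [_ _] := @commutatorP S R setT setT; apply=> // m n t a b c d _ _.
have step0 (a' b' : 'I_m -> R) : (forall i, eta0 (a' i, b' i)) ->
    delta (eval (concat a' c) t, eval (concat a' d) t) ->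
    delta (eval (concat b' c) t, eval (concat b' d) t).
  move=> ab'; apply: (centralizes_join Ceq Cmod CR C0 C1 Cd e01) => k.
  rewrite /concat; case: fintype.split => i; first by left; split.
  by right; split.
(* The passage from [a] to [b] goes through [dg a] and [dg b]: the outer moves stay inside eta0 and
   are covered by [step0], the middle one relates diagonal pairs and so stays inside delta. *)
pose dg (x : 'I_m -> R) i := rel_diag Cg (rel_fst (x i)).
move=> /(step0 a (dg a) (fun=> erefl)) h.
apply: (step0 (dg b) b) => //.
have D e : delta (eval (concat (dg a) e) t, eval (concat (dg b) e) t).
  apply: eval_cong => // k; rewrite /concat; case: fintype.split => i.
    exact: dd.
  exact: cong_refl.
apply: (cong_trans Cd (cong_sym Cd (D c))).
exact: (cong_trans Cd h (D d)).
Qed.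

(** * Syntactic congruences and complementary factors *)

Fixpoint term_subst (S : signature) (V W : Type) (s : V -> term S W)
    (t : term S V) : term S W :=
  match t with
  | Var v => s v
  | App f ts => App (fun i => term_subst s (ts i))
  end.

Lemma eval_term_subst (S : signature) (M : algebra S) (V W : Type)
    (s : V -> term S W) (e : W -> M) (t : term S V) :
  eval e (term_subst s t) = eval (fun v => eval e (s v)) t.
Proof.
elim: t => //= f ts IH; congr interp.
by apply/funext => i; apply: IH.
Qed.

(* The syntactic congruence of P, the largest one saturating P; terms with
   variables in [option M] are the unary polynomials, [None] standing for the
   unknown. *)
Definition syntactic (S : signature) (M : algebra S) (P : set M) :
    set (M * M) :=
  [set p | forall t : term S (option M),
     P (eval (oapp id p.1) t) <-> P (eval (oapp id p.2) t)].

Lemma Con_syntactic (S : signature) (M : algebra S) (P : set M) :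
  Con M (syntactic P).
Proof.
split=> [x t //|x y xy t|x y z xy yz t|f x y xy].
- by rewrite (xy t).
- by rewrite (xy t) (yz t).
pose T (u v : 'I_(arity f) -> M) := syntactic P (interp M f u, interp M f v).
apply: (@hybrid_ind _ _ T) => [z t //|u v w uv vw t|i z t /=].
  by rewrite (uv t) (vw t).
(* Only argument [i] of [f] moves. Replacing the unknown by [f] with its other arguments frozen at
   [z] yields a polynomial in that argument. *)
pose s (o : option M) : term S (option M) :=
  if o is Some _ then Var S o
  else App (@dfwith _ _ (fun k => Var S (Some (z k))) i (Var S None)).
have H m : eval (oapp id m) (term_subst s t) =
    eval (oapp id (interp M f (@dfwith _ _ z i m))) t.
  rewrite eval_term_subst; congr eval; apply/funext => -[v|] //=; congr interp.
  apply/funext => k.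
  by case: dfwithP => [|j ij]; rewrite ?dfwith_in ?dfwith_out.
by rewrite -!H; apply: xy.
Qed.

(** In the algebra gamma, let [P] be the set of pairs belonging to theta. Its syntactic congruence
    identifies all diagonal pairs, so it is full by [rel_diag_full]; as [P] contains the diagonal,
    it is everything. *)
Lemma factor_join_meet (S : signature) (C : algebra S -> Prop)
    (M : algebra S) (eta eta' theta : set (M * M)) :
  equational_class C -> congruence_modular C ->
  (forall N : algebra S, C N ->
     commutator [set: N * N] [set: N * N] = [set: N * N]) ->
  C M -> Con M eta -> Con M eta' -> Con M theta ->
  eta `&` eta' `<=` [set p | p.1 = p.2] ->
  (forall x y, exists z, eta (x, z) /\ eta' (z, y)) ->
  con_join eta theta `&` con_join eta' theta `<=` theta.
Proof.
move=> Ceq Cmod Ccomm CM Ce Ce' Ct ee comp.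
set gamma := _ `&` _.
have Cg : Con M gamma by apply: ConI; apply: Con_join.
have sub : eta `&` eta' `<=` theta.
  by move=> [x y] /ee /= ->; apply: cong_refl.
pose P : set (rel_algebra Cg) := [set p | theta (rel_fst p, rel_snd p)].
have full : syntactic P = setT.
  apply: (rel_diag_full Ceq Cmod Ccomm CM (Con_syntactic P)).
  have Peval V (e : V -> rel_algebra Cg) t : P (eval e t) =
      theta (eval (@rel_fst _ _ _ Cg \o e) t, eval (@rel_snd _ _ _ Cg \o e) t).
    by rewrite /P /mkset (hom_eval _ _ (@hom_rel_fst _ _ _ _))
      (hom_eval _ _ (@hom_rel_snd _ _ _ _)).
  have stp (b b' : set (M * M)) x y t :
      Con M b -> Con M b' -> b `&` b' `<=` theta ->
      gamma `<=` con_join b' theta -> b (x, y) ->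
      P (eval (oapp id (rel_diag Cg x)) t) ->
      P (eval (oapp id (rel_diag Cg y)) t).
    move=> Cb Cb' bb gb bxy; rewrite !Peval.
    (* The constants of the polynomial are pairs of gamma, hence of b' v theta; the unknown moves
       from [x] to [y] along [b]. *)
    apply: (centralizes_join Ceq Cmod CM Cb Cb' Ct bb) => -[p|] /=.
      by right; split=> //; apply: (gb (_, _)); apply: rel_algebraP.
    by left.
  have sub' : eta' `&` eta `<=` theta by rewrite setIC.
  have imp x y t :
      P (eval (oapp id (rel_diag Cg x)) t) ->
      P (eval (oapp id (rel_diag Cg y)) t).
    have [z [xz zy]] := comp x y.
    move=> /(stp _ _ _ _ _ Ce Ce' sub (@subIsetr _ _ _) xz).
    exact: (stp _ _ _ _ _ Ce' Ce sub' (@subIsetl _ _ _) zy).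
  by move=> x y t; split; apply: imp.
move=> [x y] gxy.
have := I : [set: rel_algebra Cg * rel_algebra Cg]
  (rel_diag Cg x, rel_pair Cg gxy).
(* The polynomial used is the bare unknown. *)
rewrite -full => /(_ (Var S None)) [/= + _]; apply.
exact: cong_refl.
Qed.

(** * Decomposing the congruences of a product *)

Lemma Con_prod_rel (S : signature) (I : Type) (A : I -> algebra S)
    (theta : forall i, set (A i * A i)) :
  (forall i, Con (A i) (theta i)) -> Con (prod_algebra A) (prod_rel theta).
Proof.
move=> Ct; split=> /= [x i|x y xy i|x y z xy yz i|f x y xy i] /=.
- exact: (cong_refl (Ct i)).
- exact: (cong_sym (Ct i) (xy i)).
- exact: (cong_trans (Ct i) (xy i) (yz i)).
- by apply: (cong_interp (Ct i)) => k; apply: xy.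
Qed.

(** Take eta to be equality at [i] and eta' equality off [i]. Then [(c, d)] is in eta', and in eta v
    theta through the path [c], [a], [b], [d], so [factor_join_meet] applies. *)
Lemma prod_con_coord (S : signature) (C : algebra S -> Prop) (I : eqType)
    (A : I -> algebra S) (theta : set (prod_algebra A * prod_algebra A))
    (i : I) (a b c d : prod_algebra A) :
  equational_class C -> congruence_modular C ->
  (forall N : algebra S, C N ->
     commutator [set: N * N] [set: N * N] = [set: N * N]) ->
  (forall j, C (A j)) -> Con (prod_algebra A) theta ->
  theta (a, b) -> c i = a i -> d i = b i ->
  (forall j, i != j -> c j = d j) -> theta (c, d).
Proof.
move=> Ceq Cmod Ccomm CA Ct ab ca db cd.
set M := prod_algebra A in theta a b c d ca db cd Ct ab *.
pose eta : set (M * M) := [set p | p.1 i = p.2 i].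
pose eta' : set (M * M) := [set p | forall j, i != j -> p.1 j = p.2 j].
have Ce : Con M eta := Con_preimage (@hom_proj _ _ A i) (@Con_diag _ (A i)).
have Ce' : Con M eta'.
  split=> /= [//|x y xy j /xy //|x y z xy yz j ij|f x y xy j ij].
    exact: etrans (xy j ij) (yz j ij).
  by congr interp; apply/funext => k; apply: xy.
apply: (factor_join_meet Ceq Cmod Ccomm (equational_prod Ceq CA) Ce Ce' Ct).
- move=> [x y] [/= xy xy']; apply/functional_extensionality_dep => j.
  by have [<-//|/xy'] := eqVneq i j.
- move=> x y; exists (dfwith y (x i)); split=> [|j ij].
    by rewrite /eta /= dfwith_in.
  by rewrite /= dfwith_out.
- split; last exact: con_joinl.
  have Cj := Con_join eta theta.
  apply: (cong_trans Cj (con_joinl (ca : eta (c, a)))).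
  apply: (cong_trans Cj (con_joinr ab)).
  by apply: con_joinl; rewrite /eta /= db.
Qed.

(** The form in which the hypotheses on the class enter the descriptions of [Con2], [Max] and [Spec]
    of a product. *)
Definition no_skew (S : signature) (I : Type) (A : I -> algebra S) : Prop :=
  forall theta, Con (prod_algebra A) theta ->
    exists2 th, (forall i, Con (A i) (th i)) & theta = prod_rel th.

(** The factor [th i] is the trace of theta on the line through a base point [w] in direction [i].
    By [prod_con_coord] other lines have the same trace, and finiteness of the index set lets
    [hybrid_ind] reassemble theta from its traces. *)
Lemma no_skew_prod (S : signature) (C : algebra S -> Prop) (n : nat)
    (A : 'I_n -> algebra S) :
  equational_class C -> congruence_modular C ->
  (forall N : algebra S, C N ->
     commutator [set: N * N] [set: N * N] = [set: N * N]) ->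
  (forall i, C (A i)) -> no_skew A.
Proof.
move=> Ceq Cmod Ccomm CA theta Ct.
have [w] := prod_inhabited A.
have coord := prod_con_coord Ceq Cmod Ccomm CA Ct.
pose th i : set (A i * A i) :=
  [set p | theta (dfwith w p.1, dfwith w p.2)].
have thE i a b : theta (a, b) -> th i (a i, b i).
  move=> ab; apply: (coord i _ _ _ _ ab); rewrite ?dfwith_in// => j ij.
  by rewrite !dfwith_out.
exists th => [i|].
  split=> /= [x|x y|x y z|f x y xy]; rewrite /th /=.
  - exact: (cong_refl Ct).
  - exact: (cong_sym Ct).
  - exact: (cong_trans Ct).
  - have := thE i _ _ (cong_interp Ct xy); rewrite /th /=.
    have wi (u : 'I_(arity f) -> A i) : (fun k => dfwith w (u k) i) = u.
      by apply/funext => k; rewrite dfwith_in.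
    by rewrite !wi.
apply/seteqP; split=> [[a b] ab i|[a b] /= ab]; first exact: thE.
apply: (@hybrid_ind n A (fun u v => theta (u, v))).
- exact: (cong_refl Ct).
- exact: (cong_trans Ct).
- move=> i z; apply: (coord i _ _ _ _ (ab i)); rewrite ?dfwith_in// => j ij.
  by rewrite !dfwith_out.
Qed.

(** * Congruences supported on one coordinate *)

Lemma Con_at_coord (S : signature) (I : eqType) (A : I -> algebra S) (i : I)
    (theta : set (A i * A i)) :
  Con (A i) theta -> Con (prod_algebra A) (at_coord A i theta).
Proof. by move=> Ct; apply: Con_prod_rel => j; case: dfwithP. Qed.

Lemma at_coordE (S : signature) (I : eqType) (A : I -> algebra S) (i : I)
    (theta : set (A i * A i)) (p : prod_algebra A * prod_algebra A) :
  at_coord A i theta p <-> theta (p.1 i, p.2 i).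
Proof.
split=> [/(_ i)|h j]; first by rewrite dfwith_in.
by case: dfwithP.
Qed.

Lemma at_coord_sub (S : signature) (I : eqType) (A : I -> algebra S) (i : I)
    (theta psi : set (A i * A i)) :
  (at_coord A i theta `<=` at_coord A i psi) = (theta `<=` psi).
Proof.
have [w] := prod_inhabited A.
apply/propext; split=> [h [x y] xy|h p /at_coordE/h hp]; last exact/at_coordE.
have /h/at_coordE /= : at_coord A i theta (dfwith w x, dfwith w y).
  by apply/at_coordE; rewrite /= !dfwith_in.
by rewrite !dfwith_in.
Qed.

Lemma at_coord_inj (S : signature) (I : eqType) (A : I -> algebra S) (i : I) :
  injective (at_coord A i).
Proof.
move=> theta psi e; apply/seteqP.
by split; rewrite -at_coord_sub e.
Qed.

Lemma at_coord_setT (S : signature) (I : eqType) (A : I -> algebra S) (i : I)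
    (theta : set (A i * A i)) :
  at_coord A i theta = setT -> theta = setT.
Proof.
move=> e; apply: at_coord_inj; rewrite e.
by apply/seteqP; split=> // p _; apply/at_coordE.
Qed.

(** Membership on the right depends on coordinate [j] only, so a reflexive pair may be altered
    freely at [i]. *)
Lemma at_coord_neq (S : signature) (I : eqType) (A : I -> algebra S) (i j : I)
    (theta : set (A i * A i)) (psi : set (A j * A j)) :
  i != j -> Con (A i) theta -> at_coord A i theta = at_coord A j psi ->
  theta = setT.
Proof.
move=> ij Ct e; apply/seteqP; split=> // -[x y] _.
have [w] := prod_inhabited A.
have : at_coord A i theta (w, w) by apply/at_coordE; apply: cong_refl.
rewrite e => /at_coordE /= h.
have : at_coord A j psi (dfwith w x, dfwith w y).
  by apply/at_coordE; rewrite /= !dfwith_out.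
by rewrite -e => /at_coordE /=; rewrite !dfwith_in.
Qed.

Lemma prod_rel_proper (S : signature) (I : eqType) (A : I -> algebra S)
    (th : forall i, set (A i * A i)) :
  prod_rel th <> setT -> exists i, th i <> setT.
Proof.
move=> pT; apply: contrapT => /forallNP h; apply: pT.
by apply/seteqP; split=> // p _ i; rewrite (contrapT (h i)).
Qed.

Lemma prod_rel_sub_coord (S : signature) (I : eqType) (A : I -> algebra S)
    (th : forall i, set (A i * A i)) (i : I) :
  prod_rel th `<=` at_coord A i (th i).
Proof. by move=> p h; apply/at_coordE. Qed.

Lemma prod_rel_sub (S : signature) (I : eqType) (A : I -> algebra S)
    (th ps : forall i, set (A i * A i)) (i : I) :
  (forall j, Con (A j) (th j)) ->
  prod_rel th `<=` prod_rel ps -> th i `<=` ps i.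
Proof.
move=> Ct h [x y] xy; have [w] := prod_inhabited A.
have /h/(_ i) /= : prod_rel th (dfwith w x, dfwith w y).
  move=> j /=; have [<-|ij] := eqVneq i j; first by rewrite !dfwith_in.
  by rewrite !dfwith_out//; apply: (cong_refl (Ct j)).
by rewrite !dfwith_in.
Qed.

Lemma prod_rel_at_coord (S : signature) (I : eqType) (A : I -> algebra S)
    (th : forall i, set (A i * A i)) (i : I) :
  (forall j, i != j -> th j = setT) -> prod_rel th = at_coord A i (th i).
Proof.
move=> h; apply/seteqP; split=> p; first exact: prod_rel_sub_coord.
move=> /at_coordE hp j; have [<-//|/h ->] := eqVneq i j.
by [].
Qed.

(** * Two-class and maximal congruences of a product *)

(** Two inequivalent elements whose classes cover [M] replace the cardinality of the quotient; this
    form can be tested coordinate by coordinate. *)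
Lemma Con2P (S : signature) (M : algebra S) (theta : set (M * M)) :
  Con2 M theta <-> Con M theta /\
    exists x y, ~ theta (x, y) /\ forall z, theta (x, z) \/ theta (y, z).
Proof.
pose cls x := [set y | theta (x, y)].
have clsE x y : Con M theta -> cls x = cls y <-> theta (x, y).
  move=> Ct; split=> [e|xy].
    have : cls y y by apply: (cong_refl Ct).
    by rewrite -e.
  apply/seteqP; split=> z; rewrite /cls /=.
    exact: (cong_trans Ct (cong_sym Ct xy)).
  exact: (cong_trans Ct xy).
rewrite /Con2 /mkset; split=> -[Ct h]; split=> //.
  move: h; rewrite card_eq_sym => /card_set_bijP[g [gf gi gs]].
  have [[x _ gx] [y _ gy]] := (gf 0 isT, gf 1 isT).
  exists x, y; split=> [/(clsE _ _ Ct) e|z].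
    have := @gi 0 1; rewrite !inE /= => /(_ isT isT).
    by rewrite -gx -gy => /(_ e).
  have [k /= + gz] : (g @` `I_2) (cls z) by apply: gs; exists z.
  case: k gz => [|[|//]] gz _; [left|right]; apply/(clsE _ _ Ct).
    by rewrite -gz -gx.
  by rewrite -gz -gy.
have [x [y [nxy hz]]] := h.
pose g k := if k is 0 then cls x else cls y.
have -> : quotient theta = g @` `I_2.
  apply/seteqP; split=> [c [z _ <-]|c [[|[|//]] _ <-]].
  - by case: (hz z) => /(clsE _ _ Ct) e; [exists 0|exists 1].
  - by exists x.
  - by exists y.
have nc : cls x <> cls y by move=> /(clsE _ _ Ct).
apply: inj_card_eq => -[|[|k]] [|[|l]]; rewrite !inE //= => _ _ // e.
  by case: nc.
Qed.

Lemma Con2_proper (S : signature) (M : algebra S) : Con2 M `<=` Con M `\ setT.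
Proof.
move=> theta /Con2P[Ct [x [y [nxy _]]]]; split=> // e.
by apply: nxy; rewrite e.
Qed.

Lemma Max_proper (S : signature) (M : algebra S) : Max M `<=` Con M `\ setT.
Proof. by move=> theta []. Qed.

Lemma Spec_proper (S : signature) (M : algebra S) : Spec M `<=` Con M `\ setT.
Proof. by move=> theta [Ct [tT _]]. Qed.

Lemma Con2_prod (S : signature) (I : eqType) (A : I -> algebra S) :
  no_skew A ->
  Con2 (prod_algebra A) =
    \bigcup_i [set at_coord A i theta | theta in Con2 (A i)].
Proof.
move=> skew; apply/seteqP; split=> [theta C2|theta [i _ [th C2 <-]]].
  have [Ct [x [y [nxy hz]]]] := iffLR (Con2P _) C2.
  have [th Cth e] := skew _ Ct.
  move: nxy hz; rewrite {}e => nxy hz {Ct C2 theta}.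
  have [i nxyi] : exists i, ~ th i (x i, y i) by apply/existsNP.
  exists i => //; exists (th i).
    apply/Con2P; split=> //; exists (x i), (y i); split=> // z.
    by case: (hz (dfwith x z)) => /(_ i) /=; rewrite dfwith_in; [left|right].
  rewrite -prod_rel_at_coord// => j ij; apply/seteqP; split=> // -[u v] _.
  (* Altering [x] at [j] keeps [x i], which is not related to [y i]; so the altered point falls in
     the class of [x]. *)
  have xj w : th j (x j, w).
    case: (hz (dfwith x w)) => [/(_ j)|/(_ i)] /=; first by rewrite dfwith_in.
    rewrite dfwith_out 1?eq_sym// => yx.
    by case: nxyi; apply: (cong_sym (Cth i)).
  exact: (cong_trans (Cth j) (cong_sym (Cth j) (xj u)) (xj v)).
have [Ct [x [y [nxy hz]]]] := iffLR (Con2P _) C2.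
apply/Con2P; split; first exact: Con_at_coord.
have [w] := prod_inhabited A.
exists (dfwith w x), (dfwith w y); split=> [/at_coordE|z].
  by rewrite /= !dfwith_in.
by case: (hz (z i)) => h; [left|right]; apply/at_coordE; rewrite /= dfwith_in.
Qed.

(** A proper product congruence lies below [at_coord A i (th i)] for any proper factor [th i], and
    maximality forces equality. Conversely, whatever lies above [at_coord A i th] is full off [i],
    so it is again supported on [i]. *)
Lemma Max_prod (S : signature) (I : eqType) (A : I -> algebra S) :
  no_skew A ->
  Max (prod_algebra A) =
    \bigcup_i [set at_coord A i theta | theta in Max (A i)].
Proof.
move=> skew; apply/seteqP.
split=> [theta [[Ct tT] mx]|theta [i _ [th [[Ct tT] mx] <-]]].
  have [th Cth e] := skew _ Ct.
  have [i thi] : exists i, th i <> setT by apply: prod_rel_proper; rewrite -e.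
  exists i => //; exists (th i); last first.
    apply: mx; last by rewrite e; apply: prod_rel_sub_coord.
    by split; [apply: Con_at_coord|move=> /at_coord_setT].
  split=> // psi [Cp pT] thp; apply: (@at_coord_inj _ _ A i).
  have th_e : at_coord A i (th i) = theta.
    apply: mx; last by rewrite e; apply: prod_rel_sub_coord.
    by split; [apply: Con_at_coord|move=> /at_coord_setT].
  rewrite th_e; apply: mx; last by rewrite -th_e at_coord_sub.
  by split; [apply: Con_at_coord|move=> /at_coord_setT].
split; first by split; [apply: Con_at_coord|move=> /at_coord_setT].
move=> psi [Cp pT] thp; have [ps Cps e] := skew _ Cp.
have psT j : i != j -> ps j = setT.
  move=> ij; apply/seteqP; split=> // -[u v] _.
  have [w] := prod_inhabited A.
  have /thp : at_coord A i th (dfwith w u, dfwith w v).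
    apply/at_coordE; rewrite /= !dfwith_out 1?eq_sym//.
    exact: (cong_refl Ct).
  by rewrite e => /(_ j) /=; rewrite !dfwith_in.
move: thp pT; rewrite e (prod_rel_at_coord psT) at_coord_sub => thp pT.
congr at_coord; apply: mx => //; split=> // psi_T; apply: pT.
by rewrite psi_T; apply/seteqP; split=> // p _; apply/at_coordE.
Qed.

(** * Commutators and prime congruences of a product *)

Lemma commutator_sub_meet (S : signature) (M : algebra S)
    (alpha beta : set (M * M)) :
  Con M alpha -> Con M beta -> commutator alpha beta `<=` alpha `&` beta.
Proof.
move=> Ca Cb; have [_ _] := commutatorP alpha beta; apply; first exact: ConI.
move=> m n t a b c d ab cd [acd _].
have step (e : 'I_n -> M) : alpha (eval (concat a e) t, eval (concat b e) t).
  apply: eval_cong => // k; rewrite /concat; case: fintype.split => // i.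
  exact: (cong_refl Ca).
split.
  apply: (cong_trans Ca (cong_sym Ca (step c))).
  exact: (cong_trans Ca acd (step d)).
apply: eval_cong => // k; rewrite /concat; case: fintype.split => // i.
exact: (cong_refl Cb).
Qed.

Lemma concat_comp (S : signature) (M N : algebra S) (h : M -> N) (m n : nat)
    (a : 'I_m -> M) (c : 'I_n -> M) :
  h \o concat a c = concat (h \o a) (h \o c).
Proof. by apply/funext => k; rewrite /concat /=; case: fintype.split. Qed.

(** The right side is the preimage of a commutator under the projection to [A i], and the term
    condition pulls back along homomorphisms. *)
Lemma commutator_at_coord (S : signature) (I : eqType) (A : I -> algebra S)
    (i : I) (alpha beta : set (A i * A i)) :
  commutator (at_coord A i alpha) (at_coord A i beta) `<=`
  at_coord A i (commutator alpha beta).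
Proof.
have [Cd cent _] := commutatorP alpha beta.
have [_ _] := commutatorP (at_coord A i alpha) (at_coord A i beta).
apply; first exact: Con_at_coord.
move=> m n t a b c d ab cd /at_coordE h; apply/at_coordE; move: h => /=.
rewrite !(hom_eval _ _ (@hom_proj _ _ A i)) !concat_comp.
by apply: cent => j; [move: (ab j)|move: (cd j)] => /at_coordE.
Qed.

(** Tuples in [A i] are lifted to the product with the constant value [w] off [i]. There both sides
    of the term condition hold by reflexivity, so the condition in the product reduces to the one at
    [i]. *)
Lemma commutator_prod_rel_sub (S : signature) (I : eqType)
    (A : I -> algebra S) (al be de : forall i, set (A i * A i)) (i : I) :
  (forall j, Con (A j) (al j)) -> (forall j, Con (A j) (be j)) ->
  (forall j, Con (A j) (de j)) ->
  commutator (prod_rel al) (prod_rel be) = prod_rel de ->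
  commutator (al i) (be i) `<=` de i.
Proof.
move=> Ca Cb Cd e; have [w] := prod_inhabited A.
have [_ _] := commutatorP (al i) (be i); apply=> // m n t a b c d ab cd.
have [_ cent _] := commutatorP (prod_rel al) (prod_rel be).
pose lf k (x : 'I_k -> A i) (l : 'I_k) : prod_algebra A := dfwith w (x l).
have lfi k (x : 'I_k -> A i) : (fun p : prod_algebra A => p i) \o lf k x = x.
  by apply/funext => l; rewrite /lf /= dfwith_in.
have lfo j k (x : 'I_k -> A i) : i != j ->
    (fun p : prod_algebra A => p j) \o lf k x = fun=> w j.
  by move=> ij; apply/funext => l; rewrite /lf /= dfwith_out.
have lift_rel (r : forall j, set (A j * A j)) k (x y : 'I_k -> A i) l :
    (forall j, Con (A j) (r j)) -> r i (x l, y l) ->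
    prod_rel r (lf k x l, lf k y l).
  move=> Cr xy j; rewrite /lf /=; have [<-|ij] := eqVneq i j.
    by rewrite !dfwith_in.
  by rewrite !dfwith_out//; apply: (cong_refl (Cr j)).
have evE (x : 'I_m -> A i) (y y' : 'I_n -> A i) :
    prod_rel de (eval (concat (lf m x) (lf n y)) t,
                 eval (concat (lf m x) (lf n y')) t) <->
    de i (eval (concat x y) t, eval (concat x y') t).
  split=> [/(_ i) /=|h j /=];
    rewrite !(hom_eval _ _ (@hom_proj _ _ A _)) !concat_comp ?lfi//.
  have [<-|ij] := eqVneq i j; first by rewrite !lfi.
  by rewrite !(lfo j)//; apply: (cong_refl (Cd j)).
move=> /evE h; apply/evE; move: h; rewrite -e; apply: cent => l.
  exact: lift_rel.
exact: lift_rel.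
Qed.

Lemma Spec_prod (S : signature) (I : eqType) (A : I -> algebra S) :
  no_skew A ->
  Spec (prod_algebra A) =
    \bigcup_i [set at_coord A i theta | theta in Spec (A i)].
Proof.
move=> skew; apply/seteqP.
split=> [phi [Cp [pT prm]]|phi [i _ [th [Ct [tT prm]] <-]]].
  have [th Cth e] := skew _ Cp.
  have [i thi] : exists i, th i <> setT by apply: prod_rel_proper; rewrite -e.
  have thT j : i != j -> th j = setT.
    move=> ij.
    (* The products of [u] and of [v] are complementary factor congruences, so their commutator is
       trivial and one of them is below phi. The first would make [th i] full; the second makes
       every other factor full. *)
    pose u : forall k, set (A k * A k) :=
      dfwith (fun k => [set p : A k * A k | p.1 = p.2]) [set: A i * A i].
    pose v : forall k, set (A k * A k) :=
      dfwith (fun k => [set: A k * A k]) ([set p : A i * A i | p.1 = p.2]).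
    have Cu : forall k, Con (A k) (u k).
      by move=> k; rewrite /u; case: dfwithP => [|l _]; last exact: Con_diag.
    have Cv : forall k, Con (A k) (v k).
      by move=> k; rewrite /v; case: dfwithP => [|l _]; first exact: Con_diag.
    have uv : commutator (prod_rel u) (prod_rel v) `<=` phi.
      move=> p /(commutator_sub_meet (Con_prod_rel Cu) (Con_prod_rel Cv)).
      case: p => x y [xy xy'].
      suff -> : x = y by apply: (cong_refl Cp).
      apply/functional_extensionality_dep => k.
      have [<-|ik] := eqVneq i k.
        by have := xy' i; rewrite /v dfwith_in.
      by have := xy k; rewrite /u dfwith_out.
    have := prm _ _ (Con_prod_rel Cu) (Con_prod_rel Cv) uv.
    rewrite e => -[] /prod_rel_sub h.
      case: thi; apply/seteqP; split=> //.
      by have := h i Cu; rewrite /u dfwith_in.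
    apply/seteqP; split=> //.
    by have := h j Cv; rewrite /v dfwith_out.
  move: prm; rewrite e (prod_rel_at_coord thT) => prm.
  exists i => //; exists (th i) => //; split=> //; split=> // al be Ca Cb ab.
  rewrite -!at_coord_sub; apply: prm; [exact: Con_at_coord..|].
  apply: subset_trans (@commutator_at_coord _ _ A i al be) _.
  by rewrite at_coord_sub.
split; first exact: Con_at_coord.
split=> [/at_coord_setT //|al be Ca Cb ab].
have Cc : Con _ (commutator al be) by case: (commutatorP al be).
have [[u Cu eu] [v Cv ev]] := (skew _ Ca, skew _ Cb).
have [d Cd ed] := skew _ Cc.
have di : d i `<=` th.
  (* Here [th] is rewritten as the value at [i] of the family defining [at_coord], for
     [prod_rel_sub] to compare factors. *)
  apply: subset_trans (_ : dfwith (fun j => [set: A j * A j]) th i `<=` th).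
    by apply: prod_rel_sub => //; rewrite -ed.
  by rewrite dfwith_in.
have [|ui|vi] := prm _ _ (Cu i) (Cv i).
- apply: subset_trans di; apply: commutator_prod_rel_sub => //.
  by rewrite -eu -ev.
- left; rewrite eu; apply: subset_trans (@prod_rel_sub_coord _ _ A u i) _.
  by rewrite at_coord_sub.
- right; rewrite ev; apply: subset_trans (@prod_rel_sub_coord _ _ A v i) _.
  by rewrite at_coord_sub.
Qed.

(** * Comparing the families over the product and over the factors *)

(** For proper theta, [at_coord A i theta] determines both [i] and theta, so each family can be
    recovered from its union. *)
Lemma bigcup_at_coord_eq (S : signature) (I : eqType) (A : I -> algebra S)
    (X Y : forall i, set (set (A i * A i))) :
  (forall i, X i `<=` Con (A i) `\ setT) ->
  (forall i, Y i `<=` Con (A i) `\ setT) ->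
  \bigcup_i [set at_coord A i theta | theta in X i] =
  \bigcup_i [set at_coord A i theta | theta in Y i] <->
  (forall i, X i = Y i).
Proof.
move=> Xp Yp; split=> [|XY]; last first.
  by apply: eq_bigcupr => i _; rewrite XY.
have sub (U V : forall i, set (set (A i * A i))) i :
    U i `<=` Con (A i) `\ setT ->
    \bigcup_i [set at_coord A i theta | theta in U i] `<=`
    \bigcup_i [set at_coord A i theta | theta in V i] -> U i `<=` V i.
  move=> Up UV th Uth; have [Ct tT] := Up _ Uth.
  have [|j _ [ps Vps e]] := UV (at_coord A i th).
    by exists i => //; exists th.
  have [ij|ij] := eqVneq i j.
    by subst j; rewrite -(at_coord_inj e).
  by case: tT; apply: (at_coord_neq ij Ct (esym e)).
by move=> e i; apply/seteqP; split; apply: sub; rewrite ?e.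
Qed.

Unset Implicit Arguments.

Theorem proposition5p3 (S : signature) (C : algebra S -> Prop)
    (C_eq : equational_class C) (C_mod : congruence_modular C)
    (C_comm : forall M : algebra S, C M ->
       commutator [set: M * M] [set: M * M] = [set: M * M])
    (n : nat) (n_ge1 : (1 <= n)%N)
    (A : 'I_n -> algebra S) (C_A : forall i, C (A i)) :
  [/\ Con2 (prod_algebra A) =
        \bigcup_(i : 'I_n) [set at_coord A i theta | theta in Con2 (A i)],
      Max (prod_algebra A) =
        \bigcup_(i : 'I_n) [set at_coord A i theta | theta in Max (A i)] /\
      (Max (prod_algebra A) = Con2 (prod_algebra A) <->
       forall i, Max (A i) = Con2 (A i)) &
      [/\ Spec (prod_algebra A) =
            \bigcup_(i : 'I_n) [set at_coord A i theta | theta in Spec (A i)],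
          Spec (prod_algebra A) = Con2 (prod_algebra A) <->
          (forall i, Spec (A i) = Con2 (A i)) &
          Spec (prod_algebra A) = Max (prod_algebra A) <->
          (forall i, Spec (A i) = Max (A i))]].
Proof.
have skew := no_skew_prod C_eq C_mod C_comm C_A.
rewrite (Con2_prod skew) (Max_prod skew) (Spec_prod skew).
split=> //; first (split=> //; apply: bigcup_at_coord_eq).
- by move=> i; apply: Max_proper.
- by move=> i; apply: Con2_proper.
split=> //; apply: bigcup_at_coord_eq => i.
- exact: Spec_proper.
- exact: Con2_proper.
- exact: Spec_proper.
- exact: Max_proper.
Qed.
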